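(* Let $\{S_t : t\in\mathbb{R}^+\}$ be the observed process of a continuous-time three-state hidden Markov model with transition rate matrix $Q$, stationary distribution $\mu=(\mu_1,\mu_2,\mu_3)$ and state-dependent probability matrix $\Pi$ with columns $\varphi_0,\dots,\varphi_{K-1}$. Let $-\lambda_1,-\lambda_2$ be the nonzero eigenvalues of $Q$ and $\nu=\mu_1a_2-\mu_2b_1$ the transition rate flux. Then for all observed states $i,j\in\{0,\dots,K-1\}$ and all $t>0$, $$\Pr\{S_0=i,S_t=j\}-\Pr\{S_0=j,S_t=i\}=\frac{\nu A}{\lambda_1-\lambda_2}\left[e^{-\lambda_2 t}-e^{-\lambda_1 t}\right],$$ where $A=(y_2-x_2)(x_1-z_1)-(x_2-z_2)(y_1-x_1)$, $(x_1,y_1,z_1)'=\varphi_i$ and $(x_2,y_2,z_2)'=\varphi_j$.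
   Context: Continuous-time three-state hidden Markov model: $\{C_t:t\in\mathbb{R}^+\}$ is an irreducible, time-homogeneous Markov process on the three states $\{1,2,3\}$ with transition rate matrix $$Q=\begin{pmatrix}-a_1&a_2&a_3\\ b_1&-b_2&b_3\\ c_1&c_2&-c_3\end{pmatrix},\quad a_1=a_2+a_3,\ b_2=b_1+b_3,\ c_3=c_1+c_2,\quad a_i,b_i,c_i\ge 0,$$ started from its stationary distribution $\mu=(\mu_1,\mu_2,\mu_3)$, $\mu_i>0$, $\sum_i\mu_i=1$. By stationarity $\mu_1a_2-\mu_2b_1=\mu_2b_3-\mu_3c_2=\mu_3c_1-\mu_1a_3$; this common value is the transition rate flux $\nu$. The state-dependent probability matrix $\Pi=(\pi(k\,|\,i))$, $i=1,2,3$, $k=0,\dots,K-1$, is a $3\times K$ matrix with nonnegative entries and rows summing to 1; $\varphi_k\in\mathbb{R}^3$ is its column indexed by $k$ and a prime denotes transpose. The observed process $\{S_t\}$ takes values in $\{0,\dots,K-1\}$; conditionally on the hidden state at time $t$, $S_t$ has law $\pi(\cdot\,|\,C_t)$ and is independent of all earlier observations and of the hidden process before time $t$. Thus for $0\le t_1<\cdots<t_n$, $\Pr(S_{t_1}=s_1,\dots,S_{t_n}=s_n)=\mu\Lambda_{s_1}P(t_2-t_1)\Lambda_{s_2}\cdots P(t_n-t_{n-1})\Lambda_{s_n}\vec e$, where $P(t)=e^{tQ}$, $\Lambda_k=\mathrm{diag}(\varphi_k)$, $\vec e=(1,1,1)'$. The eigenvalues of $Q$ are $0,-\lambda_1,-\lambda_2$,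 where $\lambda_1,\lambda_2$ are nonzero and possibly complex. When $\lambda_1=\lambda_2$, formulas containing $\frac{1}{\lambda_1-\lambda_2}$ are read as limits $\lambda_2\to\lambda_1$ (so $\frac{e^{-\lambda_2t}-e^{-\lambda_1t}}{\lambda_1-\lambda_2}$ means $te^{-\lambda_1t}$). *)

(* Defs.v *)
From HB Require Import structures.
From mathcomp Require Import all_boot all_order all_algebra.
From mathcomp Require Import all_classical all_reals all_analysis.
From mathcomp Require Import complex.
Set Implicit Arguments.
Unset Strict Implicit.
Unset Printing Implicit Defensive.
Import Order.TTheory GRing.Theory Num.Theory.
Import numFieldNormedType.Exports.
Local Open Scope classical_set_scope.
Local Open Scope ring_scope.

(* The hidden states 1, 2, 3 are the elements
   0, 1, 2 of 'I_3.  Only the random variables at times t >= 0 matter: the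
   processes are functions of all t : R, unconstrained for t < 0. *)

(* The limit is taken in the normed space of n+1 by n+1 matrices. *)
Definition expmx (R : realType) (n : nat) (A : 'M[R]_n.+1) : 'M[R]_n.+1 :=
  limn (series (fun k : nat => (k`!%:R)^-1 *: A ^+ k)).

(* With zero row sums, the diagonal entries are the -a_1, -b_2, -c_3. *)
Record rate_matrix (R : realType) (n : nat) (Q : 'M[R]_n) : Prop :=
  RateMatrix {
    rate_ge0 : forall i j, i != j -> 0 <= Q i j;
    rate_row_sum : forall i, \sum_j Q i j = 0 }.

Definition transition (R : realType) (n : nat) (Q : 'M[R]_n.+1) (t : R)
  : 'M[R]_n.+1 := expmx (t *: Q).

Definition irreducible_rate (R : realType) (n : nat) (Q : 'M[R]_n.+1) : Prop :=
  forall i j, exists2 t : R, 0 <= t & 0 < transition Q t i j.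

Record positive_stationary (R : realType) (n : nat) (Q : 'M[R]_n.+1)
    (mu : 'rV[R]_n.+1) : Prop := PositiveStationary {
  stationary_gt0 : forall i, 0 < mu 0 i;
  stationary_sum : \sum_i mu 0 i = 1;
  stationary_invariant : forall t : R, 0 <= t -> mu *m transition Q t = mu }.

Record stochastic (R : realType) (m K : nat) (Pi : 'M[R]_(m, K)) : Prop :=
  Stochastic {
    stochastic_ge0 : forall i k, 0 <= Pi i k;
    stochastic_row_sum : forall i, \sum_k Pi i k = 1 }.

Definition history (R : realType) (T : Type) (m K : nat)
    (C : R -> T -> 'I_m) (S : R -> T -> 'I_K)
    (n : nat) (u : 'I_n -> R) (c : 'I_n -> 'I_m) (s : 'I_n -> 'I_K) : set T :=
  [set w | forall k, C (u k) w = c k /\ S (u k) w = s k].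

(* Conditional probability statements P(F | E) = p are written in the
   equivalent product form P(E `&` F) = P(E) * p, which also makes sense when
   P(E) = 0.  The event in [hmm_markov] contains observations up to and
   including time r: given C_r, the evolution of the hidden process after r
   does not depend on the observations made so far.  Without it the joint law
   of an observation and a later hidden state would be undetermined.
   The case n = 0 of [hmm_emission] says that S_t has law Pi(. | C_t). *)
Record hidden_markov_model (R : realType) (d : measure_display)
    (T : measurableType d) (P : probability T R) (m K : nat)
    (Q : 'M[R]_m.+1) (mu : 'rV[R]_m.+1) (Pi : 'M[R]_(m.+1, K))
    (C : R -> T -> 'I_m.+1) (S : R -> T -> 'I_K) : Prop := HiddenMarkovModel {
  hmm_measurable_hidden :
    forall (t : R) c, 0 <= t -> measurable [set w | C t w = c];
  hmm_measurable_observed :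
    forall (t : R) s, 0 <= t -> measurable [set w | S t w = s];
  hmm_initial :
    forall c, P [set w | C 0 w = c] = (mu 0 c)%:E;
  hmm_markov :
    forall n (u : 'I_n -> R) c s (r t : R) a b,
      (forall k, 0 <= u k <= r) -> 0 <= r < t ->
      P (history C S u c s `&` [set w | C r w = a] `&` [set w | C t w = b]) =
      (P (history C S u c s `&` [set w | C r w = a])
        * (transition Q (t - r) a b)%:E)%E;
  hmm_emission :
    forall n (u : 'I_n -> R) c s (t : R) a k,
      (forall l, 0 <= u l < t) -> 0 <= t ->
      P (history C S u c s `&` [set w | C t w = a] `&` [set w | S t w = k]) =
      (P (history C S u c s `&` [set w | C t w = a]) * (Pi a k)%:E)%E }.

(* Algebraic multiplicities are counted, so that l1 = l2 is possible. *)
Definition nonzero_eigenvalues (R : realType) (Q : 'M[R]_3) (l1 l2 : R[i])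
  : Prop :=
  [/\ l1 != 0, l2 != 0 &
      char_poly (map_mx (real_complex R) Q) =
        'X * ('X + l1%:P) * ('X + l2%:P)].

Definition expC (R : realType) (z : R[i]) : R[i] :=
  Complex (expR (complex.Re z) * cos (complex.Im z)) (expR (complex.Re z) * sin (complex.Im z)).

(* (e^{- l2 t} - e^{- l1 t}) / (l1 - l2), and its limit when l1 = l2. *)
Definition exp_quotient (R : realType) (l1 l2 : R[i]) (t : R) : R[i] :=
  let tC := real_complex R t in
  if l1 == l2 then tC * expC (- (l1 * tC))
  else (expC (- (l2 * tC)) - expC (- (l1 * tC))) / (l1 - l2).

Definition flux (R : realType) (Q : 'M[R]_3) (mu : 'rV[R]_3) : R :=
  mu 0 0 * Q 0 1 - mu 0 1 * Q 1 0.

Definition coefA (R : realType) (phi1 phi2 : 'cV[R]_3) : R :=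
  let x1 := phi1 0 0 in let y1 := phi1 1 0 in let z1 := phi1 2 0 in
  let x2 := phi2 0 0 in let y2 := phi2 1 0 in let z2 := phi2 2 0 in
  (y2 - x2) * (x1 - z1) - (x2 - z2) * (y1 - x1).

Definition pair_prob (R : realType) (d : measure_display)
    (T : measurableType d) (P : probability T R) (K : nat)
    (S : R -> T -> 'I_K) (t : R) (i j : 'I_K) : R :=
  fine (P [set w | S 0 w = i /\ S t w = j]).

(* Main.v *)
Require Import Defs.
From HB Require Import structures.
From mathcomp Require Import all_boot all_order all_algebra.
From mathcomp Require Import all_classical all_reals all_analysis.
From mathcomp Require Import complex ring lra.
Import Order.TTheory GRing.Theory Num.Theory.
Import numFieldNormedType.Exports.
Local Open Scope ring_scope.

(** Write [P(t) = exp(tQ)], [f] and [g] for the columns of [Pi] at [i] and [j].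
    The Markov and emission properties give
      [Pr(S_0 = i, S_t = j) = \sum_(a, b) mu_a P(t)_ab f_a g_b]
    ([pair_probE]), so the difference of the two pair probabilities only sees
    the skew-symmetric matrix [M_ab = mu_a P(t)_ab - mu_b P(t)_ba].  Since
    [P(t)] has row sums 1 and preserves [mu], every row of [M] sums to 0.  A 3x3
    skew-symmetric matrix with zero row sums is determined by its entry [M_01],
    here the flux of [P(t)], and the bilinear form of [M] at [(f, g)] is that
    flux times [A] ([flux_skew]).

    What remains is to compute [x(t) = flux P(t)] ([flux_transition]).  As
    [P' = P Q], the derivatives of [x] are the fluxes of [P Q], [P Q^2] and
    [P Q^3].  By Cayley-Hamilton [Q^3 + (l1 + l2) Q^2 + l1 l2 Q = 0], so
    [x'' + (l1 + l2) x' + l1 l2 x] has derivative 0.  It vanishes at time 0: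
    [flux 1 = 0], and [flux Q^2 = tr Q flux Q] ([flux_mulQQ]) where
    [tr Q = - (l1 + l2)].  Hence [x] solves a homogeneous second order linear
    equation with [x(0) = 0] and [x'(0) = nu], and so does [nu] times the
    exponential quotient, both when [l1] and [l2] are distinct and when they
    coincide ([exp_quotient_ode]).  Factoring the equation into two first order
    ones gives uniqueness ([second_order_ode]).  Working with complex-valued
    functions of the real variable [t] treats real and conjugate eigenvalues
    alike. *)

(** * The matrix exponential and its derivative *)

(** A neighbourhood of a matrix contains a product of neighbourhoods of its
    finitely many entries. *)
Lemma cvg_mx_entries {K : numFieldType} {m n : nat} (u : nat -> 'M[K]_(m, n))
    (L : 'M[K]_(m, n)) :
  (forall a b, (fun k => u k a b) @ \oo --> L a b)%classic ->
  (u @ \oo --> L)%classic.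
Proof.
move=> uL A [B nbB sBA]; apply: (filterS sBA).
have FB a b : (u @ \oo)%classic (fun M => B a b (M a b)).
  exact: uL (nbB a b).
apply: (@filter_forall _ _ (fun a (M : 'M[K]_(m, n)) =>
  forall b, B a b (M a b)) (u @ \oo)%classic) => a.
apply: (@filter_forall _ _ (fun b (M : 'M[K]_(m, n)) => B a b (M a b))
  (u @ \oo)%classic) => b.
exact: FB.
Qed.

(** A crude geometric bound, enough to dominate the exponential series. *)
Lemma norm_expmx_entry {R : realDomainType} {n : nat} (A : 'M[R]_n.+1) k a b :
  `|(A ^+ k) a b| <= (\sum_i \sum_j `|A i j|) ^+ k.
Proof.
set c := \sum_i _.
have c_ge0 : 0 <= c by do 2![apply: sumr_ge0 => ? _].
elim: k a b => [|k IHk] a b.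
  by rewrite !expr0 !mxE; case: eqP; rewrite ?normr1 ?normr0.
rewrite exprSr [_ ^+ k.+1]exprSr mxE (le_trans (ler_norm_sum _ _ _))//.
apply: (@le_trans _ _ (\sum_j c ^+ k * `|A j b|)).
  by apply: ler_sum => j _; rewrite normrM ler_wpM2r.
rewrite -mulr_sumr ler_wpM2l ?exprn_ge0//; apply: ler_sum => j _.
by rewrite (bigD1 b)//= lerDl sumr_ge0.
Qed.

(** Taylor coefficients at 0 of the entry [(a, b)] of [exp(tA) D].  The factor
    [D] makes the family stable under differentiation, which replaces [D] by
    [A D]. *)
Definition transition_coeff {R : realType} {n : nat} (A D : 'M[R]_n.+1) a b
    (k : nat) : R :=
  k`!%:R^-1 * (A ^+ k *m D) a b.

(** Comparison with the exponential series at [c |t|]. *)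
Lemma is_cvg_transition_coeff {R : realType} {n : nat} (A D : 'M[R]_n.+1) a b
    (t : R) :
  cvgn (pseries (transition_coeff A D a b) t).
Proof.
pose c : R := \sum_i \sum_j `|A i j|.
pose d := \sum_j `|D j b|.
have c_ge0 : 0 <= c by do 2![apply: sumr_ge0 => ? _].
have d_ge0 : 0 <= d by rewrite sumr_ge0.
apply: normed_cvg.
apply: (@series_le_cvg _ _ (fun k => d *: exp_coeff (c * `|t|) k)) => [k|k|k|].
- exact: normr_ge0.
- by rewrite mulr_ge0// divr_ge0// exprn_ge0// mulr_ge0.
- have -> : d *: exp_coeff (c * `|t|) k = k`!%:R^-1 * (c ^+ k * d) * `|t| ^+ k.
    by rewrite /exp_coeff /= exprMn /GRing.scale /=; ring.
  rewrite /transition_coeff /= 2!normrM normfV normr_nat normrX mxE.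
  rewrite ler_wpM2r ?exprn_ge0// ler_wpM2l ?invr_ge0//.
  rewrite (le_trans (ler_norm_sum _ _ _))// /d mulr_sumr; apply: ler_sum => j _.
  by rewrite normrM ler_wpM2r//; exact: norm_expmx_entry.
- by apply: is_cvg_seriesZ; exact: is_cvg_series_exp_coeff.
Qed.

(** Limits of matrices are taken entrywise, so each entry is a real power
    series, to which termwise differentiation applies. *)
Lemma transition_entry {R : realType} {n : nat} (A D : 'M[R]_n.+1) (t : R) a b :
  (transition A t *m D) a b = limn (pseries (transition_coeff A D a b) t).
Proof.
pose L := \matrix_(i, j) limn (pseries (transition_coeff A 1%:M i j) t).
have PL : transition A t = L.
  rewrite /transition /expmx; apply: cvg_lim => //.
  apply: cvg_mx_entries => i j; rewrite mxE.
  rewrite (_ : (fun k => _) = pseries (transition_coeff A 1%:M i j) t).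
    exact: is_cvg_transition_coeff.
  apply/funext => k; rewrite /series /pseries /= summxE; apply: eq_bigr => l _.
  by rewrite /transition_coeff mulmx1 exprZn !mxE; ring.
apply/esym/cvg_lim => //; rewrite PL mxE.
rewrite (_ : pseries _ _ =
    fun k => \sum_j pseries (transition_coeff A 1%:M a j) t k * D j b).
  apply: cvg_big => [|j _]; first exact: add_continuous.
  apply: cvgM; last exact: cvg_cst.
  by rewrite mxE; exact: is_cvg_transition_coeff.
apply/funext => k; rewrite /pseries /series /=.
under [RHS]eq_bigr do rewrite mulr_suml.
rewrite exchange_big /=; apply: eq_bigr => l _.
rewrite /transition_coeff mxE mulr_sumr mulr_suml.
by apply: eq_bigr => j _; rewrite mulmx1; ring.
Qed.

(** Shifting the Taylor coefficients multiplies [D] by [A] on the left. *)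
Lemma is_derive_transition {R : realType} {n : nat} (A D : 'M[R]_n.+1) (t : R)
    a b :
  is_derive t 1 (fun s : R => (transition A s *m D) a b)
    ((transition A t *m (A *m D)) a b).
Proof.
have dE E : pseries_diffs (transition_coeff A E a b) =
    transition_coeff A (A *m E) a b.
  apply/funext => k; rewrite /pseries_diffs /transition_coeff.
  have -> : A ^+ k *m (A *m E) = A ^+ k.+1 *m E by rewrite exprSr mulmxA.
  by rewrite factS natrM invfM !mulrA divff ?mul1r// pnatr_eq0.
rewrite (_ : (fun s => _) =
    fun s => limn (pseries (transition_coeff A D a b) s)).
  rewrite transition_entry -dE.
  (* The series converge everywhere; any radius beyond [|t|] will do. *)
  apply: (@pseries_snd_diffs _ _ (`|t| + 1)); rewrite ?dE;
    try exact: is_cvg_transition_coeff.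
  by rewrite [ltRHS]ger0_norm ?ltrDl ?addr_ge0.
by apply/funext => s; rewrite transition_entry.
Qed.

Lemma transition0 {R : realType} {n : nat} (A : 'M[R]_n.+1) :
  transition A 0 = 1%:M.
Proof.
apply/matrixP => a b; rewrite -[transition A 0]mulmx1 transition_entry.
apply: lim_near_cst => //; near=> k.
have k_gt0 : (0 < k)%N by near: k; exact: nbhs_infty_gt.
rewrite /pseries /series /= -(prednK k_gt0) big_nat_recl//= big1 => [|i _].
  by rewrite addr0 /transition_coeff mulmx1 expr0 fact0 invr1 mul1r mulr1.
by rewrite exprS mul0r mulr0.
Unshelve. all: by end_near. Qed.

(** * Linear differential equations with complex coefficients *)

(** Differentiability of a complex-valued function of a real variable is read on
    its two components, so that real calculus applies to each. *)
Definition complex_derive {R : realType} (f : R -> R[i]) (t : R) (df : R[i]) :=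
  is_derive t 1 (fun s => complex.Re (f s)) (complex.Re df) /\
  is_derive t 1 (fun s => complex.Im (f s)) (complex.Im df).

Lemma complex_derive_eq {R : realType} {f : R -> R[i]} {t df df'} :
  complex_derive f t df' -> df' = df -> complex_derive f t df.
Proof. by move=> ? <-. Qed.

Lemma complex_derive_cst {R : realType} (c : R[i]) t :
  complex_derive (fun _ : R => c) t 0.
Proof. by split; apply: is_derive_cst. Qed.

Lemma complex_derive_real {R : realType} {g : R -> R} {t dg : R} :
  is_derive t 1 g dg ->
  complex_derive (fun s => real_complex R (g s)) t (real_complex R dg).
Proof. by move=> g'; split => //=; apply: is_derive_cst. Qed.

Lemma complex_deriveD {R : realType} {f g : R -> R[i]} {t df dg} :
  complex_derive f t df -> complex_derive g t dg ->
  complex_derive (fun s => f s + g s) t (df + dg).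
Proof.
move=> [f1 f2] [g1 g2]; split.
  rewrite (_ : (fun s => _) =
    (fun s => complex.Re (f s)) + (fun s => complex.Re (g s))).
    by apply: is_derive_eq; case: df dg {f1 f2 g1 g2} => [? ?] [? ?].
  by apply/funext => s; rewrite /GRing.add /=; case: (f s) (g s) => [? ?] [? ?].
rewrite (_ : (fun s => _) =
    (fun s => complex.Im (f s)) + (fun s => complex.Im (g s))).
  by apply: is_derive_eq; case: df dg {f1 f2 g1 g2} => [? ?] [? ?].
by apply/funext => s; rewrite /GRing.add /=; case: (f s) (g s) => [? ?] [? ?].
Qed.

Lemma complex_deriveM {R : realType} {f g : R -> R[i]} {t df dg} :
  complex_derive f t df -> complex_derive g t dg ->
  complex_derive (fun s => f s * g s) t (df * g t + f t * dg).
Proof.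
pose re (h : R -> R[i]) s := complex.Re (h s).
pose im (h : R -> R[i]) s := complex.Im (h s).
move=> [f1 f2] [g1 g2]; split.
  rewrite (_ : (fun s => _) = re f * re g - im f * im g).
    apply: is_derive_eq; rewrite /re /im /GRing.scale /=.
    case: df dg (f t) (g t) {f1 f2 g1 g2} => [? ?] [? ?] [? ?] [? ?] /=.
    ring.
  by apply/funext => s; rewrite !fctE /re /im; case: (f s) (g s) => [? ?] [? ?].
rewrite (_ : (fun s => _) = re f * im g + im f * re g).
  apply: is_derive_eq; rewrite /re /im /GRing.scale /=.
  by case: df dg (f t) (g t) {f1 f2 g1 g2} => [? ?] [? ?] [? ?] [? ?] /=; ring.
by apply/funext => s; rewrite !fctE /re /im; case: (f s) (g s) => [? ?] [? ?].
Qed.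

Lemma complex_derive_expC {R : realType} (l : R[i]) t :
  complex_derive (fun s => expC (- (l * real_complex R s))) t
    (- l * expC (- (l * real_complex R t))).
Proof.
case: l => a b.
have E s : - ((a +i* b)%C * real_complex R s) = ((- a * s) +i* (- b * s))%C.
  by rewrite /real_complex_def; simpc; congr Complex; ring.
pose lin (x : R) := fun s : R => x * s.
have lin' x : is_derive t 1 (lin x) x.
  by apply: (@is_derive_eq _ _ _ (lin x)); rewrite /GRing.scale /= mulr1.
split.
  rewrite (_ : (fun s => _) = (expR \o lin (- a)) * (cos \o lin (- b))).
    apply: is_derive_eq; rewrite E /GRing.scale /expC /=. ring.
  by apply/funext => s; rewrite E.
rewrite (_ : (fun s => _) = (expR \o lin (- a)) * (sin \o lin (- b))).
  apply: is_derive_eq; rewrite E /GRing.scale /expC /=. ring.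
by apply/funext => s; rewrite E.
Qed.

Lemma expC_neq0 {R : realType} (z : R[i]) : expC z != 0.
Proof.
apply/eqP => -[/eqP]; rewrite mulf_eq0 gt_eqF ?expR_gt0//= => /eqP c0.
move=> /eqP; rewrite mulf_eq0 gt_eqF ?expR_gt0//= => /eqP s0.
have := cos2Dsin2 (complex.Im z); rewrite c0 s0 expr0n addr0 => /esym/eqP.
by rewrite oner_eq0.
Qed.

Lemma complex_derive_0_is_cst {R : realType} (f : R -> R[i]) (s t : R) :
  (forall u, complex_derive f u 0) -> f s = f t.
Proof.
move=> f'; apply/eqP; rewrite eq_complex; apply/andP; split; apply/eqP.
  by apply: (@is_derive_0_is_cst _ (fun u => complex.Re (f u))) => u;
    case: (f' u).
by apply: (@is_derive_0_is_cst _ (fun u => complex.Im (f u))) => u;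
    case: (f' u).
Qed.

(** The function [f(s) e^(l s)] has derivative 0, and the exponential never
    vanishes. *)
Lemma complex_derive_unique0 {R : realType} (l : R[i]) (f : R -> R[i]) :
  (forall t, complex_derive f t (- l * f t)) -> f 0 = 0 -> forall t, f t = 0.
Proof.
move=> f' f0 t.
pose W s := f s * expC (- (- l * real_complex R s)).
have W' s : complex_derive W s 0.
  apply: complex_derive_eq
    (complex_deriveM (f' s) (complex_derive_expC (- l) s)) _.
  ring.
have /eqP := complex_derive_0_is_cst W t 0 W'.
by rewrite {2}/W f0 mul0r mulf_eq0 (negPf (expC_neq0 _)) orbF => /eqP.
Qed.

(** The quotient is the fundamental solution of the equation with characteristic
    roots [- l1] and [- l2], normalised by [h(0) = 0] and [h'(0) = 1].  For a
    double root it is [t e^(- l1 t)]. *)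
Lemma exp_quotient_ode {R : realType} (l1 l2 : R[i]) :
  exists q : R -> R[i],
    [/\ forall t, complex_derive (exp_quotient l1 l2) t (q t),
        forall t, complex_derive q t
          (- (l1 + l2) * q t - l1 * l2 * exp_quotient l1 l2 t),
        exp_quotient l1 l2 0 = 0 & q 0 = 1].
Proof.
have expC0 l : expC (- (l * real_complex R 0)) = 1.
  by rewrite rmorph0 mulr0 oppr0 /expC /= expR0 cos0 sin0 mulr0 mulr1.
pose E (l : R[i]) (t : R) : R[i] := expC (- (l * real_complex R t)).
have E' l t : complex_derive (E l) t (- l * E l t).
  exact: complex_derive_expC.
have id' t : complex_derive (fun s : R => real_complex R s) t 1.
  by apply: complex_derive_real; exact: is_derive_id.
case: (eqVneq l1 l2) => [<-|l12].
  have -> : exp_quotient l1 l1 = fun t => real_complex R t * E l1 t.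
    by apply/funext => t; rewrite /exp_quotient eqxx.
  exists (fun t => E l1 t + - l1 * (real_complex R t * E l1 t)).
  split => [t|t||].
  - apply: complex_derive_eq (complex_deriveM (id' t) (E' l1 t)) _.
    rewrite /E; ring.
  - apply: complex_derive_eq (complex_deriveD (E' l1 t)
      (complex_deriveM (complex_derive_cst (- l1) t)
         (complex_deriveM (id' t) (E' l1 t)))) _.
    rewrite /E; ring.
  - by rewrite rmorph0 mul0r.
  - by rewrite /E expC0 rmorph0 mul0r mulr0 addr0.
have l12' : l1 - l2 != 0 by rewrite subr_eq0.
have -> : exp_quotient l1 l2 = fun t => (E l2 t + - 1 * E l1 t) / (l1 - l2).
  by apply/funext => t; rewrite /exp_quotient (negPf l12) mulN1r.
exists (fun t => (l1 * E l1 t + - l2 * E l2 t) / (l1 - l2)).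
split => [t|t||].
- apply: complex_derive_eq (complex_deriveM (complex_deriveD (E' l2 t)
    (complex_deriveM (complex_derive_cst (- 1) t) (E' l1 t)))
    (complex_derive_cst (l1 - l2)^-1 t)) _.
  rewrite /E; ring.
- apply: complex_derive_eq (complex_deriveM (complex_deriveD 
    (complex_deriveM (complex_derive_cst l1 t) (E' l1 t))
    (complex_deriveM (complex_derive_cst (- l2) t) (E' l2 t)))
    (complex_derive_cst (l1 - l2)^-1 t)) _.
  rewrite /E; ring.
- by rewrite /E !expC0 mulN1r subrr mul0r.
- by rewrite /E !expC0 !mulr1 divff.
Qed.

(** The difference [Z] of two solutions with the same initial data satisfies
    [Z' + l1 Z = 0], because the left-hand side [W] solves [W' = - l2 W] and
    vanishes at 0; then [Z = 0] by the first order case again. *)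
Lemma second_order_ode {R : realType} (l1 l2 : R[i]) (g g1 : R -> R[i]) :
  (forall t, complex_derive g t (g1 t)) ->
  (forall t, complex_derive g1 t (- (l1 + l2) * g1 t - l1 * l2 * g t)) ->
  g 0 = 0 -> forall t, g t = g1 0 * exp_quotient l1 l2 t.
Proof.
move=> g' g1' g0 t; have [q [h' q' h0 q0]] := exp_quotient_ode l1 l2.
set h := exp_quotient l1 l2 in h' q' h0 *.
pose Z s := g s + - g1 0 * h s; pose Z1 s := g1 s + - g1 0 * q s.
have Z' s : complex_derive Z s (Z1 s).
  apply: complex_derive_eq (complex_deriveD (g' s)
    (complex_deriveM (complex_derive_cst (- g1 0) s) (h' s))) _.
  rewrite /Z1; ring.
have W0 s : Z1 s + l1 * Z s = 0.
  move: s; apply: (@complex_derive_unique0 _ l2) => [s|].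
    apply: complex_derive_eq (complex_deriveD (complex_deriveD (g1' s)
      (complex_deriveM (complex_derive_cst (- g1 0) s) (q' s)))
      (complex_deriveM (complex_derive_cst l1 s) (Z' s))) _.
    rewrite /Z /Z1; ring.
  by rewrite /Z /Z1 g0 h0 q0; ring.
have := @complex_derive_unique0 _ l1 Z _ _ t.
rewrite {2}/Z /= => Z0; apply/eqP; rewrite -subr_eq0 -mulNr; apply/eqP.
apply: Z0.
  move=> s; apply: complex_derive_eq (Z' s) _.
  by apply/eqP; rewrite mulNr -addr_eq0 W0.
by rewrite /Z g0 h0; ring.
Qed.

(** * Stationarity *)

(** The matrix [P(t) J], with [J] the all-ones matrix, is constant in [t], its
    derivative being [P(t) Q J = 0]. *)
Lemma transition_row_sum {R : realType} {n : nat} (Q : 'M[R]_n.+1) (t : R) a :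
  rate_matrix Q -> \sum_b transition Q t a b = 1.
Proof.
move=> [_ Qsum]; pose J : 'M[R]_n.+1 := const_mx 1.
have sumE (X : 'M[R]_n.+1) : (X *m J) a 0 = \sum_b X a b.
  by rewrite mxE; apply: eq_bigr => b _; rewrite mxE mulr1.
have QJ : Q *m J = 0.
  apply/matrixP => i j; rewrite !mxE -[RHS](Qsum i).
  by apply: eq_bigr => b _; rewrite mxE mulr1.
rewrite -sumE; transitivity ((transition Q 0 *m J) a 0).
  apply: (@is_derive_0_is_cst _ (fun s => (transition Q s *m J) a 0)) => s.
  by apply: is_derive_eq (is_derive_transition _ _ _ _ _) _;
    rewrite QJ mulmx0 mxE.
rewrite sumE transition0 (bigD1 a)//= big1 ?mxE ?eqxx ?addr0// => b ba.
by rewrite mxE eq_sym (negPf ba).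
Qed.

(** Differentiating [mu P(t) = mu] gives [mu P(t) Q = 0] and so [mu Q = 0].  The
    derivative is taken at [t = 1], an interior point of the half-line where
    stationarity is assumed. *)
Lemma stationary_mulmx0 {R : realType} {n : nat} (Q : 'M[R]_n.+1)
    (mu : 'rV[R]_n.+1) :
  positive_stationary Q mu -> mu *m Q = 0.
Proof.
move=> stat_mu; have muP := stationary_invariant stat_mu; apply/rowP => b.
have dP j : is_derive (1 : R) 1 (fun s : R => mu 0 j * transition Q s j b)
    (mu 0 j * (transition Q 1 *m Q) j b).
  have := is_derive_transition Q 1%:M (1 : R) j b; rewrite mulmx1.
  under eq_fun do rewrite mulmx1.
  move=> H; exact: (@is_deriveZ _ _ _ _ (mu 0 j) _ _ _ H).
have d1 := is_derive_sum dP.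
have d2 : is_derive (1 : R) 1
   (\sum_j (fun s : R => mu 0 j * transition Q s j b)) 0.
  apply: (@near_eq_is_derive _ _ _ (cst (mu 0 b))).
  near=> s; have s_ge0 : 0 <= s by apply: ltW; near: s; exact: (lt_nbhsr ltr01).
  by rewrite fct_sumE /= -{1}(muP s s_ge0) mxE.
have := @derive_val _ _ _ _ _ _ _ d1; rewrite (@derive_val _ _ _ _ _ _ _ d2).
move=> dE.
by rewrite -{1}(muP 1 ler01) -mulmxA [LHS]mxE [RHS]mxE -dE.
Unshelve. all: by end_near. Qed.

(** * The flux of a three-state matrix *)

Lemma sum_ord3 {V : nmodType} (F : 'I_3 -> V) :
  \sum_i F i = F 0 + F 1 + F 2.
Proof.
rewrite !big_ord_recl big_ord0 addr0 addrA.
by congr (_ + _ + _); congr F; apply: val_inj.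
Qed.

(** The matrix [mu_a X_ab - mu_b X_ba] is skew-symmetric with zero row sums,
    hence the flux of [X] times the matrix with rows [(0, 1, -1)], [(-1, 0, 1)],
    [(1, -1, 0)], whose bilinear form is [coefA]. *)
Lemma flux_skew {R : realType} (X : 'M[R]_3) (mu : 'rV[R]_3) (f g : 'cV[R]_3) :
  (forall a, \sum_b X a b = 1) -> mu *m X = mu ->
  \sum_a \sum_b mu 0 a * X a b * (f a 0 * g b 0 - g a 0 * f b 0) =
  flux X mu * coefA f g.
Proof.
move=> rowX muX.
have row_ a : mu 0 a * (X a 0 + X a 1 + X a 2) = mu 0 a.
  by rewrite -sum_ord3 rowX mulr1.
have col_ b : mu 0 0 * X 0 b + mu 0 1 * X 1 b + mu 0 2 * X 2 b = mu 0 b.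
  by rewrite -{4}muX mxE sum_ord3.
(* The flux is the same across each of the three edges of the cycle. *)
have m12 : mu 0 1 * X 1 2 = mu 0 2 * X 2 1 + flux X mu.
  rewrite /flux; move: (row_ 1) (col_ 1); rewrite !mulrDr; lra.
have m20 : mu 0 2 * X 2 0 = mu 0 0 * X 0 2 + flux X mu.
  rewrite /flux; move: (row_ 0) (col_ 0); rewrite !mulrDr; lra.
have m01 : mu 0 0 * X 0 1 = mu 0 1 * X 1 0 + flux X mu by rewrite /flux; lra.
rewrite sum_ord3 !sum_ord3 m12 m20 m01 /coefA; ring.
Qed.

(** Split the matrix product by the intermediate state.  The first two states
    contribute [(Q_00 + Q_11) nu], with [nu] the flux of [Q].  Since the flux is
    the same along all edges of the cycle, the third state contributes
    [- (Q_20 + Q_21) nu], which is [Q_22 nu] by the zero row sum. *)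
Lemma flux_mulQQ {R : realType} (Q : 'M[R]_3) (mu : 'rV[R]_3) :
  rate_matrix Q -> mu *m Q = 0 ->
  flux (Q *m Q) mu = \tr Q * flux Q mu.
Proof.
move=> [_ rowQ] muQ.
have q22 : Q 2 2 = - Q 2 0 - Q 2 1.
  by have := rowQ 2; rewrite sum_ord3; lra.
have col_ b : mu 0 0 * Q 0 b + mu 0 1 * Q 1 b + mu 0 2 * Q 2 b = 0.
  by have /rowP/(_ b) := muQ; rewrite !mxE sum_ord3.
have row_ a : mu 0 a * (Q a 0 + Q a 1 + Q a 2) = 0.
  by rewrite -sum_ord3 rowQ mulr0.
have m12 : mu 0 1 * Q 1 2 = mu 0 2 * Q 2 1 + flux Q mu.
  rewrite /flux; move: (row_ 1) (col_ 1); rewrite !mulrDr; lra.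
have m02 : mu 0 0 * Q 0 2 = mu 0 2 * Q 2 0 - flux Q mu.
  rewrite /flux; move: (row_ 0) (col_ 0); rewrite !mulrDr; lra.
have -> : flux (Q *m Q) mu = (Q 0 0 + Q 1 1) * flux Q mu +
    (mu 0 0 * Q 0 2) * Q 2 1 - (mu 0 1 * Q 1 2) * Q 2 0.
  by rewrite /flux !mxE !sum_ord3; ring.
by rewrite /mxtrace sum_ord3 m02 m12 q22; ring.
Qed.

(** * Eigenvalues *)

Lemma eigenvalues_trace {R : realType} (Q : 'M[R]_3) (l1 l2 : R[i]) :
  nonzero_eigenvalues Q l1 l2 -> real_complex R (\tr Q) = - (l1 + l2).
Proof.
move=> [_ _ chiE]; have := char_poly_trace (map_mx (real_complex R) Q) isT.
rewrite chiE /=; rewrite trace_map_mx => /(congr1 -%R); rewrite opprK => <-.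
have -> : 'X * ('X + l1%:P) * ('X + l2%:P) =
    'X^3 + (l1 + l2) *: 'X^2 + (l1 * l2) *: 'X :> {poly R[i]}.
  rewrite -!mul_polyC rmorphD rmorphM /=. ring. 
by rewrite !coefE /= mulr1 mulr0 add0r addr0.
Qed.

(** Cayley-Hamilton for the factored characteristic polynomial.  It is stated on
    entries because [l1] and [l2] are complex while the matrices are real. *)
Lemma eigenvalues_cube {R : realType} (Q : 'M[R]_3) (l1 l2 : R[i])
    (X : 'M[R]_3) a b :
  nonzero_eigenvalues Q l1 l2 ->
  real_complex R ((X *m (Q *m (Q *m Q))) a b) =
    - (l1 + l2) * real_complex R ((X *m (Q *m Q)) a b) -
    l1 * l2 * real_complex R ((X *m Q) a b).
Proof.
move=> [_ _ chiE]; set q := map_mx (real_complex R) Q.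
have := Cayley_Hamilton q; rewrite chiE !rmorphM !rmorphD /=.
rewrite horner_mx_X !horner_mx_C => CH.
have E (Y : 'M[R]_3) : real_complex R (Y a b) = (map_mx (real_complex R) Y) a b.
  by rewrite mxE.
have CH3 : q *m (q *m q) = - ((l1 + l2) *: (q *m q)) - (l1 * l2) *: q.
  apply/eqP; rewrite -subr_eq0 opprD !opprK; apply/eqP; rewrite -[RHS]CH.
  rewrite -!mulmxE mulmxDr mulmxDr !mulmxDl !mul_mx_scalar -!mulmxA.
  by rewrite scalerDl scalerA [l2 * l1]mulrC -scalemxAl !addrA.
rewrite (E (X *m (Q *m (Q *m Q)))) (E (X *m (Q *m Q))) (E (X *m Q)).
rewrite !map_mxM -/q CH3; set x := map_mx _ X.
rewrite mulmxDr !mulmxN -!scalemxAr.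
by move: (x *m (q *m q)) (x *m q) => Y2 Y1; rewrite !mxE mulNr.
Qed.

(** * The flux of the transition matrix *)

Lemma is_derive_flux_transition {R : realType} (Q D : 'M[R]_3) (mu : 'rV[R]_3)
    (t : R) :
  is_derive t 1 (fun s : R => flux (transition Q s *m D) mu)
    (flux (transition Q t *m (Q *m D)) mu).
Proof.
have d01 := is_derive_transition Q D t 0 1.
have d10 := is_derive_transition Q D t 1 0.
exact: (is_deriveB (is_deriveZ (mu 0 0) d01) (is_deriveZ (mu 0 1) d10)).
Qed.

(** The flux of [P(t)] solves the second order equation of the exponential
    quotient, with initial velocity [flux Q]. *)
Lemma flux_transition {R : realType} (Q : 'M[R]_3) (mu : 'rV[R]_3)
    (l1 l2 : R[i]) (t : R) :
  rate_matrix Q -> positive_stationary Q mu -> nonzero_eigenvalues Q l1 l2 ->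
  real_complex R (flux (transition Q t) mu) =
  real_complex R (flux Q mu) * exp_quotient l1 l2 t.
Proof.
move=> rateQ statmu eigQ.
pose g D (s : R) : R[i] := real_complex R (flux (transition Q s *m D) mu).
have g' D s : complex_derive (g D) s (g (Q *m D) s).
  exact/complex_derive_real/is_derive_flux_transition.
have gE D : g D 0 = real_complex R (flux D mu) by rewrite /g transition0 mul1mx.
have g3 s : g (Q *m (Q *m Q)) s = - (l1 + l2) * g (Q *m Q) s - l1 * l2 * g Q s.
  rewrite /g /flux !rmorphB !rmorphM /= !(eigenvalues_cube Q l1 l2)//.
  ring.
(* The residual of the equation is constant by [g3] and vanishes at time 0. *)
pose h s := g (Q *m Q) s + ((l1 + l2) * g Q s + l1 * l2 * g 1%:M s).
have h' s : complex_derive h s 0.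
  have g1' := g' 1%:M s; rewrite mulmx1 in g1'.
  apply: complex_derive_eq (complex_deriveD (g' (Q *m Q) s)
    (complex_deriveD (complex_deriveM (complex_derive_cst (l1 + l2) s) (g' Q s))
      (complex_deriveM (complex_derive_cst (l1 * l2) s) g1'))) _.
  rewrite g3; ring.
have flux1 : flux (1%:M : 'M[R]_3) mu = 0 by rewrite /flux !mxE/= !mulr0 subrr.
have h0 s : h s = 0.
  rewrite (complex_derive_0_is_cst h s 0 h') /h !gE flux_mulQQ//; last first.
    exact: stationary_mulmx0.
  rewrite flux1 rmorphM /= (eigenvalues_trace Q l1 l2)// rmorph0; ring.
have gI s : g 1%:M s = real_complex R (flux (transition Q s) mu).
  by rewrite /g mulmx1.
rewrite -gI -gE; apply: second_order_ode => [s|s|].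
- by have := g' 1%:M s; rewrite mulmx1.
- apply: complex_derive_eq (g' Q s) _.
  apply/eqP; rewrite -subr_eq0; apply/eqP; rewrite -[RHS](h0 s) /h; ring.
- by rewrite gE flux1 rmorph0.
Qed.

(** * Joint law of two observations *)

Section PairLaw.
Local Open Scope classical_set_scope.
Local Open Scope ring_scope.

Lemma measure_fibers {R : realType} {d : measure_display} {T : measurableType d}
    (P : {measure set T -> \bar R}) {n : nat} (X : T -> 'I_n) (E : set T) :
  measurable E -> (forall c, measurable [set w | X w = c]) ->
  P E = (\sum_c P (E `&` [set w | X w = c]))%E.
Proof.
move=> mE mX.
rewrite -measure_bigsetU_ord => [|c|].
- rewrite -bigcup_seq; congr (P _); apply/seteqP; split => [w Ew|w [c _ []]//].
  by exists (X w) => //=; exact: mem_index_enum.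
- exact: measurableI.
- by move=> a b _ _ [w [[_ /= <-] [_ /= <-]]].
Qed.

(** The pair event splits according to the hidden states at the two times.  On
    each piece, the emission at [t], the transition from 0 to [t], the emission
    at 0 and the initial law contribute one factor each. *)
Lemma pair_probE {R : realType} {d : measure_display}
    {T : measurableType d} (P : probability T R) (m K : nat)
    (Q : 'M[R]_m.+1) (mu : 'rV[R]_m.+1) (Pi : 'M[R]_(m.+1, K))
    (C : R -> T -> 'I_m.+1) (S : R -> T -> 'I_K) (t : R) (i j : 'I_K) :
  hidden_markov_model P Q mu Pi C S -> 0 < t ->
  pair_prob P S t i j =
    \sum_a \sum_b mu 0 a * transition Q t a b * (Pi a i * Pi b j).
Proof.
move=> hmm t_gt0; have t_ge0 := ltW t_gt0.
have mC := hmm_measurable_hidden hmm; have mS := hmm_measurable_observed hmm.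
pose H a := history C S (fun _ : 'I_1 => 0) (fun=> a) (fun=> i).
have HE a : H a = ([set w | C 0 w = a] `&` [set w | S 0 w = i]).
  by apply/seteqP; split=> [w /(_ ord0)|w [cw sw] l].
have joint a b : P (H a `&` [set w | C t w = b] `&` [set w | S t w = j]) =
    (mu 0 a * transition Q t a b * (Pi a i * Pi b j))%:E.
  rewrite (hmm_emission hmm)// => [|l]; last by rewrite lexx.
  have HI : H a = (H a `&` [set w | C 0 w = a]).
    by rewrite HE setIAC setIid.
  rewrite -/(H a) HI (hmm_markov hmm) ?lexx//.
  rewrite -/(H a) -HI HE subr0.
  (* An empty history turns the emission property into the law of [S_0] given
     [C_0]. *)
  have := @hmm_emission _ _ _ _ _ _ _ _ _ _ _ hmm 0 (fun=> 0) (fun=> a)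
    (fun=> i) 0 a i.
  rewrite [history _ _ _ _ _](_ : _ = setT); last first.
    by apply/seteqP; split=> // w _ [].
  rewrite !setTI (hmm_initial hmm) => ->//; last by case.
  by rewrite -!EFinM; congr (_%:E); ring.
rewrite -[RHS]/(fine _%:E); congr fine; set E := [set w | _].
have mE : measurable E.
  rewrite (_ : E = [set w | S 0 w = i] `&` [set w | S t w = j])//.
  by apply: measurableI; apply: mS.
rewrite (measure_fibers P (C 0))// => [|c]; last exact: mC.
rewrite -sumEFin; apply: eq_bigr => a _.
rewrite (measure_fibers P (C t)) => [||c]; last exact: mC.
  rewrite -sumEFin; apply: eq_bigr => b _.
  rewrite -joint HE; congr (P _).
  by apply/seteqP; split => w /=; rewrite /E /=; tauto.
by apply: measurableI => //; exact: mC.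
Qed.

End PairLaw.

(** * The antisymmetric part of the joint law *)

Theorem proposition2p2 (R : realType) (d : measure_display)
    (T : measurableType d) (P : probability T R) (K : nat)
    (Q : 'M[R]_3) (mu : 'rV[R]_3) (Pi : 'M[R]_(3, K))
    (C : R -> T -> 'I_3) (S : R -> T -> 'I_K) (l1 l2 : R[i]) :
  rate_matrix Q -> irreducible_rate Q -> positive_stationary Q mu ->
  stochastic Pi -> hidden_markov_model P Q mu Pi C S ->
  nonzero_eigenvalues Q l1 l2 ->
  forall (i j : 'I_K) (t : R), 0 < t ->
    real_complex R (pair_prob P S t i j - pair_prob P S t j i) =
    real_complex R (flux Q mu * coefA (col i Pi) (col j Pi))
      * exp_quotient l1 l2 t.
Proof.
move=> rateQ _ statmu _ hmm eigQ i j t t_gt0.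
rewrite [RHS](_ : _ = real_complex R (flux Q mu) * exp_quotient l1 l2 t *
    real_complex R (coefA (col i Pi) (col j Pi))); last first.
  by rewrite rmorphM /=; ring.
rewrite -flux_transition// -rmorphM /= -flux_skew; last 2 first.
- by move=> a; exact: transition_row_sum.
- exact: stationary_invariant statmu t (ltW t_gt0).
congr (real_complex R _); rewrite !(pair_probE P 2 K Q mu Pi C)//.
rewrite -sumrB; apply: eq_bigr => a _; rewrite -sumrB; apply: eq_bigr => b _.
by rewrite -mulrBr !mxE.
Qed.
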